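(* Let $\gamma=(\gamma_1,\dots,\gamma_{r+1})$ be a partition of $n$, and let $\theta$ be a complex skew-symmetric $n\times n$ matrix. The only structure equations contained in the noncommutative Young symmetry relations are those within a single factor of the algebra $\mathcal A(\mathbb{CP}_\Theta(\gamma;n))$ involving minors whose multi-indices differ in only one index. That is: if the Young symmetry relation associated to $(d,d',I,J)$ is a structure equation, then $d=d'$, and the multi-indices of the two minors involved differ in only one index.
   Context: Put $d_i=\sum_{a\le i}\gamma_a$, $q_{ij}=\exp(\tfrac{\mathrm i}{2}\theta^{ij})$ and $Q_{ij;kl}=q_{ki}q_{jl}$. $\mathcal F_n^\theta$ is generated by $g_{ij}$, $1\le i,j\le n$, with $g_{ij}g_{kl}=Q^2_{ij;kl}\,g_{kl}g_{ij}$. For a column multi-index $J=(j_1\cdots j_m)$, the order $m$ minor (rows $1,\dots,m$) is $$\Lambda^{J}=\sum_{\sigma\in S_m}\mathrm{sgn}(\sigma)\Big(\prod_{1\le a<b\le m}Q_{b\,j_{\sigma(b)}\,;\,a\,j_{\sigma(a)}}\Big)g_{1j_{\sigma(1)}}\cdots g_{mj_{\sigma(m)}};$$ it vanishes if $J$ has repeated indices, and under permutation of its indices it changes only by sign. $\mathbb{CP}_\Theta(\gamma;n)$ is the noncommutative deformation of $\mathbb{CP}^{N_1}\times\cdots\times\mathbb{CP}^{N_r}$, $N_i=\binom n{d_i}-1$, the homogeneous coordinates of the $i$-th factor being labelled by ordered multi-indices of length $d_i$ (representing the minors of order $d_i$), with the noncommutativity relations of the minors. So minors of equal size belong to a single factor,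 and minors of different sizes belong to different factors. The noncommutative Young symmetry relations are, for $d,d'\in\{d_1,\dots,d_{r+1}\}$ with $d\ge d'$ and multi-indices $I=(i_1\cdots i_{d+1})$, $J=(j_1\cdots j_{d'-1})$ formed from subsets of $\{1,\dots,n\}$ (distinct entries, not necessarily ordered), $$\sum_{\alpha=1}^{d+1}(-1)^{\alpha+1}\Big(\prod_{\mu=1}^{d}q_{i_\alpha i^\alpha_\mu}\Big)\Big(\prod_{\nu=1}^{d'-1}q_{i_\alpha j_\nu}\Big)\Lambda^{I^\alpha}\,\Lambda^{i_\alpha\cup J}=0,$$ where $I^\alpha=(i^\alpha_1\cdots i^\alpha_d)$ is $I$ with $i_\alpha$ removed and $i_\alpha\cup J=(i_\alpha\,j_1\cdots j_{d'-1})$. A term vanishes when $i_\alpha\cup J$ contains a repeated index, i.e. $i_\alpha\in J$. Such a relation is a structure equation if exactly two terms survive (are not vanishing because of repeated indices) and they involve distinct noncommuting coordinates, so that the equation expresses a commutation relation between two coordinates. *)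

(* Defs.v *)
From HB Require Import structures.
From mathcomp Require Import all_boot all_order all_fingroup all_algebra.
From mathcomp Require Import complex.
From mathcomp Require Import reals sequences exp trigo.

Set Implicit Arguments.
Unset Strict Implicit.
Unset Printing Implicit Defensive.

Import GRing.Theory Num.Theory.
Local Open Scope ring_scope.
Local Open Scope complex_scope.

Definition cexp (R : realType) (z : R[i]) : R[i] :=
  let: a +i* b := z in (expR a * cos b) +i* (expR a * sin b).

(* Ordered partitions (the parts need not be monotone), with positive parts. *)
Definition is_partition (n r : nat) (gamma : 'I_r.+1 -> nat) : Prop :=
  (forall i, 0 < gamma i)%N /\ (\sum_i gamma i)%N = n.

(* Indices start at 0: [psum gamma i] is d_(i+1), so that the r factors have
   sizes [psum gamma i] for i < r, and [psum gamma r] = n. *)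
Definition psum (r : nat) (gamma : 'I_r.+1 -> nat) (i : nat) : nat :=
  (\sum_(a < r.+1 | a <= i) gamma a)%N.

(* Homogeneous coordinates.  An ordered multi-index is given by its set of
   entries.  Since the parts are positive, the sizes d_1 < ... < d_r are
   distinct and the factor a coordinate belongs to is determined by its size. *)
Definition is_hcoord (n r : nat) (gamma : 'I_r.+1 -> nat) : pred {set 'I_n} :=
  fun S => [exists i : 'I_r, #|S| == psum gamma i].

Definition hcoord (n r : nat) (gamma : 'I_r.+1 -> nat) : Type :=
  {S : {set 'I_n} | is_hcoord gamma S}.

Definition in_factor (n r : nat) (gamma : 'I_r.+1 -> nat) (i : 'I_r)
    (X : hcoord n gamma) : Prop :=
  #|val X| = psum gamma i.

Definition differ_in_one_index (n : nat) (S T : {set 'I_n}) : Prop :=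
  #|S :\: T| = 1%N /\ #|T :\: S| = 1%N.

Lemma card_set_ord_le (n : nat) (S : {set 'I_n}) : (#|S| <= n)%N.
Proof. by apply: leq_trans (max_card _) _; rewrite card_ord. Qed.

Section Deformation.

Variables (R : realType) (n : nat) (theta : 'M[R[i]]_n).

Definition q (i j : 'I_n) : R[i] := cexp ('i / 2%:R * theta i j).

Definition Q (i j k l : 'I_n) : R[i] := q k i * q j l.

(* [g] is a family of elements of A satisfying the defining relations of the
   algebra F_n^theta.  An identity holds in an algebra presented by generators
   and relations iff it holds for every such family in every algebra; this is
   how identities in presented algebras are expressed below. *)
Definition Fn_relations (A : algType R[i]) (g : 'I_n -> 'I_n -> A) : Prop :=
  forall i j k l, g i j * g k l = Q i j k l ^+ 2 *: (g k l * g i j).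

Definition minor (A : algType R[i]) (g : 'I_n -> 'I_n -> A)
    (m : nat) (le_mn : (m <= n)%N) (J : 'I_m -> 'I_n) : A :=
  let row := widen_ord le_mn in
  \sum_(s : 'S_m)
    ((-1) ^+ s *
     \prod_(a < m) \prod_(b < m | (a < b)%N)
       Q (row b) (J (s b)) (row a) (J (s a))) *:
    \prod_(a < m) g (row a) (J (s a)).

(* The minor of an increasing multi-index ([enum_val] is increasing here). *)
Definition set_minor (A : algType R[i]) (g : 'I_n -> 'I_n -> A)
    (S : {set 'I_n}) : A :=
  minor g (card_set_ord_le S) (enum_val : 'I_#|S| -> 'I_n).

(* The identity Lambda^S Lambda^T = c Lambda^T Lambda^S in F_n^theta. *)
Definition minors_q_commute (S T : {set 'I_n}) (c : R[i]) : Prop :=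
  forall (A : algType R[i]) (g : 'I_n -> 'I_n -> A), Fn_relations g ->
    set_minor g S * set_minor g T = c *: (set_minor g T * set_minor g S).

Variables (r : nat) (gamma : 'I_r.+1 -> nat).

(* The defining relations of the homogeneous coordinate algebra of
   CP_Theta(gamma; n): those between the corresponding minors. *)
Definition CP_relations (A : algType R[i]) (x : hcoord n gamma -> A) : Prop :=
  forall (X Y : hcoord n gamma) (c : R[i]),
    minors_q_commute (val X) (val Y) c -> x X * x Y = c *: (x Y * x X).

Definition noncommuting (X Y : hcoord n gamma) : Prop :=
  ~ forall (A : algType R[i]) (x : hcoord n gamma -> A),
      CP_relations x -> x X * x Y = x Y * x X.

Fixpoint inversions (K : seq 'I_n) : nat :=
  if K is i :: K' then (count (fun j : 'I_n => j < i) K' + inversions K')%N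
  else 0%N.

(* Lambda^K for an arbitrary multi-index K, in terms of the coordinates: zero
   if K has repeated indices, and otherwise the coordinate of the sorted
   multi-index up to the sign of the sorting permutation.  The second 0 only
   concerns multi-indices whose length is not one of d_1, ..., d_r. *)
Definition Lambda (A : algType R[i]) (x : hcoord n gamma -> A)
    (K : seq 'I_n) : A :=
  if uniq K then
    (-1) ^+ inversions K *:
      oapp x 0 (insub [set i | i \in K] : option (hcoord n gamma))
  else 0.

Section Young.

Variables (d d' : nat) (I : d.+1.-tuple 'I_n) (J : d'.-1.-tuple 'I_n).

Definition left_index (alpha : 'I_d.+1) : seq 'I_n :=
  take alpha I ++ drop alpha.+1 I.

Definition right_index (alpha : 'I_d.+1) : seq 'I_n := tnth I alpha :: J.

(* As alpha starts at 0, the sign (-1)^(alpha+1) becomes (-1)^alpha. *)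
Definition young_coeff (alpha : 'I_d.+1) : R[i] :=
  (-1) ^+ alpha
  * (\prod_(i <- left_index alpha) q (tnth I alpha) i)
  * (\prod_(j <- J) q (tnth I alpha) j).

(* The left-hand side of the Young symmetry relation, for an arbitrary family
   x of values of the coordinates. *)
Definition young (A : algType R[i]) (x : hcoord n gamma -> A) : A :=
  \sum_(alpha < d.+1) young_coeff alpha *:
    (Lambda x (left_index alpha) * Lambda x (right_index alpha)).

Definition survives (alpha : 'I_d.+1) : bool :=
  uniq (left_index alpha) && uniq (right_index alpha).

Definition is_structure_equation : Prop :=
  #|[set alpha | survives alpha]| = 2%N /\
  forall alpha, survives alpha ->
    exists X Y : hcoord n gamma,
      [/\ val X = [set i | i \in left_index alpha],
          val Y = [set i | i \in right_index alpha],
          X <> Y & noncommuting X Y].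

Definition involves_exactly (X Y : hcoord n gamma) : Prop :=
  forall alpha, survives alpha ->
    [set [set i | i \in left_index alpha]; [set i | i \in right_index alpha]]
    = [set val X; val Y].

(* No relation is imposed on x: the equivalence holds at the level of the
   (free) equation, not merely because both sides vanish. *)
Definition expresses_commutation (X Y : hcoord n gamma) : Prop :=
  exists2 c : R[i], c != 0 &
    forall (A : algType R[i]) (x : hcoord n gamma -> A),
      young x = 0 <-> x X * x Y = c *: (x Y * x X).

End Young.

End Deformation.

(* Main.v *)
Require Import Defs.
From mathcomp Require Import all_boot all_order all_fingroup all_algebra.
From mathcomp Require Import complex.
From mathcomp Require Import reals sequences exp trigo.

Import Order.TTheory GRing.Theory Num.Theory.
Local Open Scope ring_scope.
Local Open Scope complex_scope.

(** The argument is a count of indices. As [I] has distinct entries, the term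
    at [alpha] survives iff the entry of [I] at [alpha] is not in [J]. So a
    relation with exactly two surviving terms, [a] and [b], has
    [#|I :\: J| = 2], hence [#|I :&: J| = d - 1]. But [J] has only
    [d' - 1 <= d - 1] entries, so [d' = d], and [I] consists of [J] together
    with two more indices [i_a] and [i_b] ([two_survivors_index_sets]).

    The minors in the term at [a] are therefore indexed by [J + i_b] and
    [J + i_a], and those in the term at [b] by the same two sets in the
    opposite order. This gives at once that the two minors have the same size
    and differ in one index, and that the relation has the form
    [u X Y + v Y X = 0]. It expresses a commutation relation because [u] and
    [v] are, up to sign, products of values of [q], hence of the complex
    exponential, and so do not vanish ([young_coeff_neq0]). *)

Section Coefficients.

Set Implicit Arguments.
Unset Strict Implicit.

Variables (R : realType) (n : nat) (theta : 'M[R[i]]_n).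

Lemma cexp_neq0 (z : R[i]) : cexp z != 0.
Proof.
case: z => a b; apply/eqP => -[/eqP].
rewrite mulf_eq0 gt_eqF ?expR_gt0 //= => /eqP cos0 /eqP.
rewrite mulf_eq0 gt_eqF ?expR_gt0 //= => /eqP sin0.
have := cos2Dsin2 b; rewrite cos0 sin0 expr0n addr0 => /esym /eqP.
by rewrite oner_eq0.
Qed.

Lemma young_coeff_neq0 (d d' : nat) (I : d.+1.-tuple 'I_n)
    (J : d'.-1.-tuple 'I_n) (alpha : 'I_d.+1) :
  young_coeff theta I J alpha != 0.
Proof.
rewrite /young_coeff !mulf_neq0 ?signr_eq0 //.
  by rewrite prodf_seq_neq0; apply/allP => i _; rewrite cexp_neq0.
by rewrite prodf_seq_neq0; apply/allP => i _; rewrite cexp_neq0.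
Qed.

End Coefficients.

Section Indices.

Set Implicit Arguments.
Unset Strict Implicit.

Variables (n d d' : nat) (I : d.+1.-tuple 'I_n) (J : d'.-1.-tuple 'I_n).
Hypotheses (uI : uniq I) (uJ : uniq J).

Local Notation "[ 'entries' K ]" := [set i | i \in K].

Lemma perm_left_index (alpha : 'I_d.+1) :
  perm_eq I (tnth I alpha :: left_index I alpha).
Proof.
rewrite -cat1s perm_sym perm_catCA /= (tnth_nth (tnth I alpha)).
by rewrite -drop_nth ?size_tuple // cat_take_drop.
Qed.

Lemma uniq_left_index (alpha : 'I_d.+1) : uniq (left_index I alpha).
Proof.
by have := uI; rewrite (perm_uniq (perm_left_index alpha)) => /andP[].
Qed.

Lemma left_index_entries (alpha : 'I_d.+1) :
  [entries left_index I alpha] = [entries I] :\ tnth I alpha.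
Proof.
apply/setP => i; rewrite !inE (perm_mem (perm_left_index alpha)) inE.
have := uI; rewrite (perm_uniq (perm_left_index alpha)) /= => /andP[notin _].
by case: eqVneq => [->|//]; exact/negbTE.
Qed.

Lemma survivesE (alpha : 'I_d.+1) :
  survives I J alpha = (tnth I alpha \notin J).
Proof. by rewrite /survives uniq_left_index /= uJ andbT. Qed.

Lemma card_survivors :
  #|[set alpha | survives I J alpha]| = #|[entries I] :\: [entries J]|.
Proof.
rewrite -(card_imset _ (elimT (tuple_uniqP I) uI)); congr #|pred_of_set _|.
apply/setP => i; rewrite !inE; apply/imsetP/andP.
  by case=> alpha; rewrite inE survivesE => ? ->; rewrite mem_tnth.
by case=> iJ /tnthP[alpha def_i]; exists alpha; rewrite // inE survivesE -def_i.
Qed.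

Lemma card_entries (K : seq 'I_n) : uniq K -> #|[entries K]| = size K.
Proof. by move=> uK; rewrite cardsE; apply/card_uniqP. Qed.

(** Two survivors leave [d - 1] entries of [I] to be found among the [d' - 1]
    entries of [J], which forces equality everywhere. The bound [0 < d'] keeps
    [d'.-1] from being a truncated value. *)
Lemma two_survivors_sizes :
  (0 < d')%N -> (d' <= d)%N -> #|[set alpha | survives I J alpha]| = 2%N ->
  d = d' /\ [entries J] \subset [entries I].
Proof.
move=> d'_gt0 le_d'd; rewrite card_survivors => cardD.
have := cardsID [entries J] [entries I].
rewrite cardD (card_entries uI) size_tuple addn2 => -[cardI].
have cardJ : #|[entries J]| = d'.-1 by rewrite card_entries // size_tuple.
have cap_le : (#|[entries I] :&: [entries J]| <= d'.-1)%N.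
  exact: leq_trans (subset_leq_card (subsetIr _ _)) (eq_leq cardJ).
have eq_d : d = d'.
  apply/eqP; rewrite eqn_leq le_d'd -cardI andbT.
  by rewrite (leq_ltn_trans cap_le) // prednK.
split=> //; apply/setIidPr/eqP.
by rewrite eqEcard subsetIr cardJ /= -ltnS prednK // cardI.
Qed.

(** With [I] made of [J], [i_a] and [i_b], removing [i_a] from [I] gives the
    same set as adding [i_b] to [J]: the two surviving terms hold the same two
    minors in opposite orders. *)
Lemma two_survivors_index_sets (a b : 'I_d.+1) :
  a != b -> [set alpha | survives I J alpha] = [set a; b] ->
  [entries J] \subset [entries I] ->
  [entries left_index I a] = [entries right_index I J b].
Proof.
move=> neq_ab surv /subsetP sJI; rewrite left_index_entries.
have notin_J c : c \in [set a; b] -> tnth I c \notin J.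
  by rewrite -surv inE survivesE.
apply/setP => i; rewrite !inE; apply/andP/orP.
  case=> neq_ia /tnthP[c def_i].
  have [|iJ] := boolP (i \in J); first by right.
  left; have: c \in [set a; b] by rewrite -surv inE survivesE -def_i.
  rewrite !inE => /orP[] /eqP ec; last by rewrite def_i ec.
  by rewrite def_i ec eqxx in neq_ia.
case=> [/eqP -> | iJ].
  by rewrite mem_tnth (inj_eq (elimT (tuple_uniqP I) uI)) eq_sym.
have := sJI i; rewrite !inE => -> //; split=> //.
by apply: contraTneq iJ => ->; apply: notin_J; rewrite !inE eqxx.
Qed.

Lemma differ_in_one_index_add1 (a b : 'I_d.+1) :
  a != b -> survives I J a -> survives I J b ->
  differ_in_one_index [entries right_index I J b] [entries right_index I J a].
Proof.
have one c e : c != e -> survives I J c ->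
    #|[entries right_index I J c] :\: [entries right_index I J e]| = 1%N.
  rewrite survivesE => neq_ce notin_J.
  apply/eqP/cards1P; exists (tnth I c); apply/setP => i; rewrite !inE negb_or.
  have [-> | _] := eqVneq i (tnth I c); last by case: (i \in J); rewrite ?andbF.
  by rewrite notin_J (inj_eq (elimT (tuple_uniqP I) uI)) neq_ce.
by move=> neq_ab sa sb; split; apply: one; rewrite // eq_sym.
Qed.

End Indices.

Lemma psum_gt0 {n r : nat} {gamma : 'I_r.+1 -> nat} (k : nat) :
  is_partition n gamma -> (0 < psum gamma k)%N.
Proof. by case=> pos _; rewrite /psum (bigD1 ord0) //= addn_gt0 pos. Qed.

Section Relation.

Set Implicit Arguments.
Unset Strict Implicit.

Variables (R : realType) (n r : nat) (gamma : 'I_r.+1 -> nat).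
Variables (theta : 'M[R[i]]_n) (A : algType R[i]) (x : hcoord n gamma -> A).

Lemma Lambda_hcoord (K : seq 'I_n) (X : hcoord n gamma) :
  uniq K -> val X = [set i | i \in K] ->
  Lambda x K = (-1) ^+ inversions K *: x X.
Proof. by move=> uK XK; rewrite /Lambda uK -XK valK. Qed.

Lemma young_term (d d' : nat) (I : d.+1.-tuple 'I_n) (J : d'.-1.-tuple 'I_n)
    (alpha : 'I_d.+1) (X Y : hcoord n gamma) :
  survives I J alpha ->
  val X = [set i | i \in left_index I alpha] ->
  val Y = [set i | i \in right_index I J alpha] ->
  young_coeff theta I J alpha *:
    (Lambda x (left_index I alpha) * Lambda x (right_index I J alpha))
  = (young_coeff theta I J alpha
     * (-1) ^+ inversions (left_index I alpha)
     * (-1) ^+ inversions (right_index I J alpha)) *: (x X * x Y).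
Proof.
case/andP=> ul ur /(Lambda_hcoord ul) -> /(Lambda_hcoord ur) ->.
by rewrite -scalerAl -scalerAr !scalerA.
Qed.

Lemma young_two_survivors (d d' : nat) (I : d.+1.-tuple 'I_n)
    (J : d'.-1.-tuple 'I_n) (a b : 'I_d.+1) :
  a != b -> [set alpha | survives I J alpha] = [set a; b] ->
  let term alpha := young_coeff theta I J alpha *:
    (Lambda x (left_index I alpha) * Lambda x (right_index I J alpha)) in
  young theta I J x = term a + term b.
Proof.
move=> neq_ab surv term; rewrite /young (bigD1 a) //= (bigD1 b) 1?eq_sym //=.
rewrite big1 ?addr0 // => c /andP[ca cb].
have: ~~ survives I J c.
  by move/setP/(_ c): surv; rewrite !inE (negPf ca) (negPf cb) /= => ->.
rewrite negb_and /Lambda => /orP[] /negPf ->.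
  by rewrite mul0r scaler0.
by rewrite mulr0 scaler0.
Qed.

Lemma lin2_eq0 (u v : R[i]) (y z : A) : u != 0 ->
  u *: y + v *: z = 0 <-> y = (- (u^-1 * v)) *: z.
Proof.
move=> u0; split=> [/eqP | ->].
  rewrite addr_eq0 => /eqP e.
  by rewrite scaleNr -scalerA -scalerN -e scalerA mulVf // scale1r.
by rewrite scaleNr scalerN scalerA mulrA divff // mul1r addNr.
Qed.

End Relation.

Theorem proposition5p18 (R : realType) (n r : nat) (gamma : 'I_r.+1 -> nat)
    (hgamma : is_partition n gamma)
    (theta : 'M[R[i]]_n) (htheta : theta^T = - theta)
    (d d' : nat)
    (hd : exists k : 'I_r.+1, d = psum gamma k)
    (hd' : exists k : 'I_r.+1, d' = psum gamma k)
    (hdd' : (d' <= d)%N)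
    (I : d.+1.-tuple 'I_n) (J : d'.-1.-tuple 'I_n)
    (hI : uniq I) (hJ : uniq J)
    (hS : is_structure_equation theta gamma I J) :
  d = d' /\
  exists X Y : hcoord n gamma,
    [/\ involves_exactly I J X Y,
        expresses_commutation theta I J X Y,
        exists k : 'I_r, in_factor k X /\ in_factor k Y
      & differ_in_one_index (val X) (val Y)].
Proof.
case: hS => card_surv coords.
have d'_gt0 : (0 < d')%N by case: hd' => k ->; apply: psum_gt0 hgamma.
have [eq_d sJI] := two_survivors_sizes hI hJ d'_gt0 hdd' card_surv.
split=> //.
have /cards2P[a [b [neq_ab surv]]] := introT eqP card_surv.
have sa : survives I J a by move/setP/(_ a): surv; rewrite !inE eqxx.
have sb : survives I J b by move/setP/(_ b): surv; rewrite !inE eqxx orbT.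
have surv' : [set alpha | survives I J alpha] = [set b; a] by rewrite setUC.
have left_a := two_survivors_index_sets hI hJ neq_ab surv sJI.
have neq_ba : b != a by rewrite eq_sym.
have left_b := two_survivors_index_sets hI hJ neq_ba surv' sJI.
have [X [Y [Xa Ya _ _]]] := coords a sa.
have Xb : val X = [set i | i \in right_index I J b] by rewrite Xa.
have Yb : val Y = [set i | i \in left_index I b] by rewrite Ya.
have differ : differ_in_one_index (val X) (val Y).
  by rewrite Xb Ya; exact: differ_in_one_index_add1.
exists X, Y; split=> //.
- move=> c sc; have : c \in [set a; b] by rewrite -surv inE.
  by rewrite !inE => /orP[] /eqP ->; rewrite -?Xa -?Ya -?Xb -?Yb // setUC.
- pose coeff c := young_coeff theta I J c
    * (-1) ^+ inversions (left_index I c)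
    * (-1) ^+ inversions (right_index I J c).
  have coeff_neq0 c : coeff c != 0.
    by do 2!(apply: mulf_neq0; last by rewrite signr_eq0); exact: young_coeff_neq0.
  exists (- ((coeff a)^-1 * coeff b)) => [|A x].
    by rewrite oppr_eq0 mulf_neq0 ?invr_neq0.
  rewrite (young_two_survivors theta x neq_ab surv) /=.
  rewrite (young_term theta x sa Xa Ya).
  rewrite (young_term theta x sb Yb Xb).
  by apply: lin2_eq0; exact: coeff_neq0.
- have /existsP[k /eqP Xk] := valP X; exists k; split=> //.
  case: differ => XY YX; rewrite /in_factor -Xk.
  by rewrite -(cardsID (val X) (val Y)) YX -(cardsID (val Y) (val X)) XY setIC.
Qed.
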